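(* Let $\mathbb K$ be an algebraically closed field of characteristic $0$ and let $f\in\mathbb K[x]$ be a polynomial of type $(k,m)$, where $k\ge 0$, $m\ge 0$ are integers. Then the following holds. 1) If $m\le 1$, then $f$ has a full integral. 2) If $m>k+1$, then $f$ does not have a full integral. 3) For any pair $(k,m)$ satisfying neither $m\le 1$ nor $m>k+1$, and any sequence of integers $\alpha_1,\ldots,\alpha_m$ with all $\alpha_i>1$, both possibilities occur: a) there exists a polynomial $f_1\in\mathbb K[x]$ of type $(k,m)$ whose multiple zeros have multiplicities $\alpha_1,\ldots,\alpha_m$ and which has a full integral; and b) there exists a polynomial $f_2\in\mathbb K[x]$ of type $(k,m)$ whose multiple zeros have multiplicities $\alpha_1,\ldots,\alpha_m$ and which has no full integral.
   Context: A polynomial $p\in\mathbb K[x]$ is of type $(k,m)$ if it has exactly $k$ different simple zeros and exactly $m$ different multiple zeros (zeros of multiplicity at least $2$); in particular $p\neq 0$. A polynomial $P\in\mathbb K[x]$ is a full integral of $p\in\mathbb K[x]$ if $P'=p$ and every multiple zero of $p$ is a zero of $P$, i.e. for every $\lambda\in\mathbb K$ with $(x-\lambda)^2\mid p$ one has $(x-\lambda)\mid P$. Derivatives are formal derivatives. *)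

(* Defs.v *)
From HB Require Import structures.
From mathcomp Require Import all_boot all_order all_algebra.

Set Implicit Arguments.
Unset Strict Implicit.
Unset Printing Implicit Defensive.

Import GRing.Theory.
Local Open Scope ring_scope.

Definition simple_zero (K : fieldType) (p : {poly K}) (x : K) : bool :=
  mup x p == 1%N.

Definition multiple_zero (K : fieldType) (p : {poly K}) (x : K) : bool :=
  (1 < mup x p)%N.

Definition exactly (T : eqType) (n : nat) (P : pred T) : Prop :=
  exists s : seq T, [/\ uniq s, size s = n & forall x, (x \in s) = P x].

Definition poly_type (K : fieldType) (k m : nat) (p : {poly K}) : Prop :=
  [/\ p != 0, exactly k (simple_zero p) & exactly m (multiple_zero p)].

(* Multiplicities are prescribed up to the labelling of the multiple zeros:
   [z] enumerates them bijectively, and [z i] has multiplicity [alpha i]. *)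
Definition multiple_zeros_mult (K : fieldType) (m : nat)
    (alpha : 'I_m -> nat) (p : {poly K}) : Prop :=
  exists z : 'I_m -> K,
    [/\ injective z,
        forall x, multiple_zero p x <-> exists i, x = z i
      & forall i, mup (z i) p = alpha i].

Definition is_full_integral (K : fieldType) (p P : {poly K}) : Prop :=
  P^`() = p /\
  forall a : K, ('X - a%:P) ^+ 2 %| p -> 'X - a%:P %| P.

Definition has_full_integral (K : fieldType) (p : {poly K}) : Prop :=
  exists P : {poly K}, is_full_integral p P.

(* Main.v *)
(** At a multiple zero [a] of [f] a full integral [P] vanishes, and in
    characteristic 0 it does so to order one more than [f]; summing these
    orders over the [m] multiple zeros and comparing with
    [deg P = deg f + 1] gives [m <= k + 1].

    For the existence statements all prescribed zeros are integers, so that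
    everything is defined over the rationals and real analysis applies.
    (a) [P = prod_(i <= k) (X - i)^(e_i + 1)], with [e_i = alpha_i] for [i < m]
    and [e_i = 0] otherwise, is a full integral of
    [P' = prod_(i <= k) (X - i)^(e_i) * Q] with [deg Q = k].  By Rolle, [Q] has
    a real root in each interval [(i, i + 1)], hence is separable over the
    rationals, hence over [K].
    (b) [f = prod_(i < m + k) (X - i)^(e_i)] has no zero in [(0, 1)], so by
    Rolle no antiderivative of [f] takes the same value at the multiple zeros
    [0] and [1]. *)
From HB Require Import structures.
Require Import Defs.
From mathcomp Require Import all_boot all_order all_algebra.
From mathcomp Require Import separable polyrcf realalg zify ring.
Local Open Scope ring_scope.

Set Implicit Arguments.
Unset Strict Implicit.
Unset Printing Implicit Defensive.

Import Order.TTheory GRing.Theory Num.Theory.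

(** * Fields of characteristic 0: embedding of the rationals, antiderivatives, multiplicities *)

Section Char0.
Variable F : fieldType.
Hypothesis F0 : [pchar F] =i pred0.

Lemma pchar0_natr_eq0 n : (n%:R == 0 :> F) = (n == 0)%N.
Proof. exact: (pcharf0P F).1. Qed.

Lemma pchar0_natr_inj : injective (fun n : nat => n%:R : F).
Proof.
move=> m n /= /eqP; wlog le_mn : m n / (m <= n)%N.
  by move=> W; case/orP: (leq_total m n) => /W // W'; rewrite eq_sym => /W'.
rewrite eq_sym -subr_eq0 -natrB // pchar0_natr_eq0 subn_eq0 => le_nm.
by apply/eqP; rewrite eqn_leq le_mn.
Qed.

Lemma pchar0_intr_eq0 z : (z%:~R == 0 :> F) = (z == 0).
Proof.
by case: z => n; rewrite ?NegzE ?rmorphN ?oppr_eq0 /= -pmulrn pchar0_natr_eq0.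
Qed.

(** [ratr] is computed from the reduced fraction; cross-multiplication extends its formula to every
    fraction, so the morphism laws can be checked without reducing. *)
Lemma pchar0_ratr_frac (a b : int) :
  b != 0 -> ratr (a%:~R / b%:~R) = a%:~R / b%:~R :> F.
Proof.
move=> b0; set x := _ / _; apply/eqP.
rewrite /ratr eqr_div ?pchar0_intr_eq0 ?denq_eq0 // -!intrM; apply/eqP.
congr _%:~R; apply: (@intr_inj rat); rewrite !intrM numqE.
by rewrite mulrAC divfK ?intr_eq0.
Qed.

(* The library makes [ratr] a ring morphism only into a [numFieldType]; the
   dummy argument lets the structure be inferred for any field of
   characteristic 0. *)
Definition pchar0_ratr of [pchar F] =i pred0 : rat -> F := ratr.

Lemma pchar0_ratr_zmod_morphism : zmod_morphism (pchar0_ratr F0).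
Proof.
move=> x y; have [dx dy] := (denq_neq0 x, denq_neq0 y).
rewrite -{1}[x]divq_num_den -{1}[y]divq_num_den -mulNr -rmorphN.
rewrite addf_div ?intr_eq0 // -!rmorphM -rmorphD /pchar0_ratr.
rewrite pchar0_ratr_frac ?mulf_neq0 // rmorphD !rmorphM rmorphN.
by rewrite -addf_div ?pchar0_intr_eq0 // mulNr.
Qed.

Lemma pchar0_ratr_monoid_morphism : monoid_morphism (pchar0_ratr F0).
Proof.
split=> [|x y]; first exact: (ratr_nat F 1).
have [dx dy] := (denq_neq0 x, denq_neq0 y).
rewrite -{1}[x]divq_num_den -{1}[y]divq_num_den mulf_div -!rmorphM.
by rewrite /pchar0_ratr pchar0_ratr_frac ?mulf_neq0 // !rmorphM -mulf_div.
Qed.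

HB.instance Definition _ := GRing.isZmodMorphism.Build rat F
  (pchar0_ratr F0) pchar0_ratr_zmod_morphism.
HB.instance Definition _ := GRing.isMonoidMorphism.Build rat F
  (pchar0_ratr F0) pchar0_ratr_monoid_morphism.

Lemma pchar0_deriv_eq0 (p : {poly F}) : p^`() = 0 -> exists c, p = c%:P.
Proof.
move=> p'0; exists p`_0; apply: size1_polyC; apply/leq_sizeP => [[//|i] _].
have /eqP := coef_deriv p i; rewrite p'0 coef0 eq_sym -mulr_natr mulf_eq0.
by rewrite pchar0_natr_eq0 orbF => /eqP.
Qed.

(* The constant coefficient is [p`_0 / 0 = 0]. *)
Definition antideriv (p : {poly F}) : {poly F} :=
  \poly_(i < (size p).+1) (p`_i.-1 / i%:R).

Lemma antiderivK p : (antideriv p)^`() = p.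
Proof.
apply/polyP => i; rewrite coef_deriv coef_poly ltnS /=.
case: ltnP => [_|le_pi]; last by rewrite mul0rn nth_default.
by rewrite -[LHS]mulr_natr divfK // pchar0_natr_eq0.
Qed.

(** Write [p] as [q] times the power [r + 1] of ['X - x], with [x] not a root of [q]. In the
    derivative, the cofactor of the power [r] takes at [x] the value [r + 1] times [q.[x]], which is
    nonzero in characteristic 0. *)
Lemma pchar0_mup_deriv (p : {poly F}) x :
  p != 0 -> root p x -> mup x p = (mup x p^`()).+1.
Proof.
move=> p0 px; have [n [q qx Dp]] := multiplicity_XsubC p x.
rewrite p0 /= in qx.
have mup_p : mup x p = n by rewrite Dp mupMr // mup_XsubCX eqxx.
have : (0 < n)%N by rewrite -mup_p -XsubC_dvd // dvdp_XsubCl.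
rewrite mup_p {mup_p p0 px}; case: n Dp => [//|r] -> _; congr _.+1.
have -> : (q * ('X - x%:P) ^+ r.+1)^`() =
    (q^`() * ('X - x%:P) + q *+ r.+1) * ('X - x%:P) ^+ r.
  rewrite derivM deriv_exp derivXsubC mul1r exprS mulrA mulrDl.
  by rewrite mulrnAl mulrnAr.
rewrite mupMr ?mup_XsubCX ?eqxx // rootE !hornerE hornerMn subrr mulr0 add0r.
by rewrite -mulr_natr mulf_eq0 pchar0_natr_eq0 orbF.
Qed.

End Char0.

(** * Products over natural-number nodes and their derivatives *)

(** Natural numbers as nodes let field morphisms carry the product from one field to another; an
    exponent 0 leaves a node out. *)
Definition node_prod (F : fieldType) (e : nat -> nat) n : {poly F} :=
  \prod_(i < n) ('X - (i%:R)%:P) ^+ e i.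

(* The cofactor of [node_prod e n] in the derivative of
   [node_prod (fun i => (e i).+1) n]. *)
Fixpoint critical (F : fieldType) (e : nat -> nat) n : {poly F} :=
  if n is n'.+1 then
    critical F e n' * ('X - (n'%:R)%:P)
      + (e n').+1%:R *: node_prod F (fun=> 1%N) n'
  else 0.

Section Nodes.
Variable F : fieldType.
Implicit Types (e : nat -> nat) (n i : nat) (x : F).

Lemma node_prodS e n :
  node_prod F e n.+1 = node_prod F e n * ('X - (n%:R)%:P) ^+ e n.
Proof. by rewrite /node_prod big_ord_recr. Qed.

Lemma node_prod0 e : node_prod F e 0 = 1.
Proof. by rewrite /node_prod big_ord0. Qed.

Lemma map_node_prod (F' : fieldType) (f : {rmorphism F -> F'}) e n :
  map_poly f (node_prod F e n) = node_prod F' e n.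
Proof.
rewrite rmorph_prod; apply: eq_bigr => i _.
by rewrite rmorphXn rmorphB /= map_polyX map_polyC /= rmorph_nat.
Qed.

Lemma root_node_prod e n x :
  root (node_prod F e n) x -> exists2 i, (i < n)%N & (0 < e i)%N && (x == i%:R).
Proof.
elim: n => [|n IHn]; first by rewrite node_prod0 (negPf (root1 _)).
rewrite node_prodS rootM => /orP[/IHn[i lt_in xi]|].
  by exists i => //; apply: ltnW.
case Den: (e n) => [|r]; first by rewrite expr0 (negPf (root1 _)).
by rewrite root_exp_XsubC => xn; exists n; rewrite ?Den.
Qed.

Lemma root_node_prodT e n i :
  (i < n)%N -> (0 < e i)%N -> root (node_prod F e n) i%:R.
Proof.
elim: n => [//|n IHn]; rewrite ltnS leq_eqVlt node_prodS rootM.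
case/orP=> [/eqP-> e_gt0|/IHn/[apply] -> //].
by rewrite -(prednK e_gt0) root_exp_XsubC eqxx orbT.
Qed.

Lemma size_node_prod1 n : size (node_prod F (fun=> 1%N) n) = n.+1.
Proof.
by rewrite /node_prod size_prod_XsubC /index_enum -enumT size_enum_ord.
Qed.

Lemma deriv_node_prod e n :
  (node_prod F (fun i => (e i).+1) n)^`() = node_prod F e n * critical F e n.
Proof.
(* Splitting off one copy of each factor lets [node_prod F e] factor out of both terms of the
   product rule. *)
have prodS k : node_prod F (fun i => (e i).+1) k =
    node_prod F e k * node_prod F (fun=> 1%N) k.
  by rewrite -big_split /=; apply: eq_bigr => i _; rewrite -exprD addn1.
elim: n => [|n IHn]; first by rewrite !node_prod0 mulr0 derivC.
rewrite node_prodS derivM IHn prodS node_prodS deriv_exp derivXsubC mul1r /=.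
rewrite exprS -mul_polyC rmorph_nat -mulr_natr; set y := (_.+1)%:R; ring.
Qed.

Lemma map_critical (F' : fieldType) (f : {rmorphism F -> F'}) e n :
  map_poly f (critical F e n) = critical F' e n.
Proof.
elim: n => [|n IHn] /=; first by rewrite rmorph0.
rewrite rmorphD rmorphM rmorphB /= IHn map_polyX map_polyC linearZ_LR.
by rewrite /= !rmorph_nat map_node_prod.
Qed.

Lemma size_critical e n : (size (critical F e n) <= n)%N.
Proof.
elim: n => [|n IHn] /=; first by rewrite size_poly0.
apply: leq_trans (size_polyD _ _) _; rewrite geq_max; apply/andP; split.
  apply: leq_trans (size_polyMleq _ _) _; rewrite size_XsubC addn2 /=.
  by rewrite ltnS.
by apply: leq_trans (size_scale_leq _ _) _; rewrite size_node_prod1.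
Qed.

(** At the last node only the second summand of [critical] survives, a nonzero multiple of a product
    of differences of nodes. At an earlier node that summand vanishes and induction applies to the
    first. *)
Lemma critical_node_neq0 e n i : [pchar F] =i pred0 ->
  (i < n)%N -> ~~ root (critical F e n) i%:R.
Proof.
move=> F0; elim: n => [//|n IHn] /=; rewrite ltnS leq_eqVlt rootE !hornerE.
case/orP=> [/eqP->|lt_in].
  rewrite subrr mulr0 add0r mulf_neq0 ?pchar0_natr_eq0 //.
  apply/negP => /root_node_prod[j lt_jn /andP[_ /eqP]].
  by move/(pchar0_natr_inj F0) => nj; rewrite nj ltnn in lt_jn.
have /eqP-> : root (node_prod F (fun=> 1%N) n) i%:R by apply: root_node_prodT.
rewrite mulr0 addr0 mulf_neq0 ?IHn // subr_eq0.
by apply: contraTneq lt_in => /(pchar0_natr_inj F0)->; rewrite ltnn.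
Qed.

End Nodes.

(** * Critical points over a real closed field *)

Section RealNodes.
Variable R : rcfType.

Lemma node_interval_neq (i j : nat) (x : R) :
  i%:R < x -> x < i.+1%:R -> x != j%:R.
Proof.
move=> lt_ix lt_xi; apply/eqP => Dx; move: lt_ix lt_xi.
by rewrite Dx !ltr_nat ltnS => /leq_trans/[apply]; rewrite ltnn.
Qed.

(** The [n - 1] roots given by Rolle, one per gap between nodes, already exhaust the degree bound,
    so the polynomial is a constant times a product of distinct linear factors. *)
Lemma critical_separable e n : (0 < n)%N ->
  separable_poly (critical R e n) /\ size (critical R e n) = n.
Proof.
case: n => [//|k] _.
have R0 := pchar_num R.
have rootc (i : 'I_k) : exists c : R,
    [/\ i%:R < c, c < i.+1%:R & root (critical R e k.+1) c].
  have lt_i1 : i%:R < i.+1%:R :> R by rewrite ltr_nat.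
  have rootP j : (j < k.+1)%N ->
      (node_prod R (fun i => (e i).+1) k.+1).[j%:R] = 0.
    by move=> lt_jk; apply/eqP; apply: root_node_prodT.
  have [|c] := @poly_rolle R _ _ (node_prod R (fun i => (e i).+1) k.+1) lt_i1.
    by rewrite !rootP // ltnS // ltnW.
  rewrite inE /= => /andP[lt_ic lt_ci] /eqP.
  rewrite deriv_node_prod hornerM mulf_eq0 => /orP[|cc]; last by exists c.
  (* A point strictly between consecutive nodes is not a node, so the root cannot come from
     [node_prod]. *)
  case/root_node_prod=> j _ /andP[_].
  by rewrite (negPf (node_interval_neq _ lt_ic lt_ci)).
have [c cP] := fin_all_exists rootc.
have inj_c : injective c.
  suff lt_c (i j : 'I_k) : (i < j)%N -> c i < c j.
    move=> i j Dc; apply: val_inj.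
    by case: (ltngtP i j) => // /lt_c; rewrite Dc ltxx.
  move=> lt_ij; have [[_ + _] [+ _ _]] := (cP i, cP j).
  by move=> /lt_trans h /(le_lt_trans _)/h; apply; rewrite ler_nat.
have crit0 : critical R e k.+1 != 0.
  apply: contraNneq (critical_node_neq0 e R0 (ltn0Sn k)) => ->.
  exact: root0.
pose p := \prod_(x <- codom c) ('X - x%:P).
have size_p : size p = k.+1 by rewrite size_prod_XsubC size_codom card_ord.
have uniq_c : uniq (codom c) by rewrite codomE map_inj_uniq ?enum_uniq.
have dvd_p : p %| critical R e k.+1.
  apply: uniq_roots_dvdp; last by rewrite uniq_rootsE.
  by apply/allP => _ /codomP[i ->]; have [] := cP i.
have size_c : size (critical R e k.+1) = k.+1.
  apply/eqP; rewrite eqn_leq size_critical -{1}size_p.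
  exact: dvdp_leq.
split=> //; have := dvdp_size_eqp dvd_p; rewrite size_c size_p eqxx => /esym.
by move/eqp_separable=> <-; rewrite separable_prod_XsubC.
Qed.

End RealNodes.

(** * Type and multiplicities read off a factored form *)

Lemma prod_XsubC_type (F : fieldType) (m : nat) (alpha : 'I_m -> nat)
    (z : 'I_m -> F) (rs : seq F) (c : F) :
  c != 0 -> (forall i, (1 < alpha i)%N) -> injective z -> uniq rs ->
  (forall i, z i \notin rs) ->
  let f := c *: (\prod_(i < m) ('X - (z i)%:P) ^+ alpha i
                  * \prod_(r <- rs) ('X - r%:P)) in
  [/\ poly_type (size rs) m f, multiple_zeros_mult alpha f
    & forall x, multiple_zero f x = (x \in codom z)].
Proof.
move=> c0 alpha_gt1 inj_z uniq_rs zNrs f.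
have roots0 : \prod_(r <- rs) ('X - r%:P) != 0.
  by rewrite monic_neq0 ?monic_prod_XsubC.
have nodes0 : \prod_(i < m) ('X - (z i)%:P) ^+ alpha i != 0.
  by apply/prodf_neq0 => i _; rewrite expf_neq0 ?polyXsubC_eq0.
have mupf x : mup x f =
    (mup x (\prod_(i < m) ('X - (z i)%:P) ^+ alpha i) + (x \in rs))%N.
  rewrite /f -mul_polyC mupMr; last by rewrite rootC.
  by rewrite mupM // mu_prod_XsubC count_uniq_mem.
have rootz x : root (\prod_(i < m) ('X - (z i)%:P) ^+ alpha i) x ->
    exists i, x = z i.
  rewrite rootE horner_prod => /eqP/eqP/prodf_eq0[i _].
  rewrite -rootE -(prednK (ltnW (alpha_gt1 i))) root_exp_XsubC => /eqP.
  by exists i.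
have mupz i : mup (z i) f = alpha i.
  rewrite mupf (negPf (zNrs i)) addn0 (bigD1 i) //= mupMl ?mup_XsubCX ?eqxx //.
  rewrite rootE horner_prod; apply/prodf_neq0 => j neq_ji; rewrite horner_exp.
  by rewrite expf_neq0 // hornerXsubC subr_eq0 (inj_eq inj_z) eq_sym.
have mupNz x : (forall i, x != z i) -> mup x f = (x \in rs).
  move=> xNz; rewrite mupf mupNroot //; apply/negP => /rootz[i xz].
  by have := xNz i; rewrite xz eqxx.
have multf x : multiple_zero f x = (x \in codom z).
  have [/codomP[i ->]|xNz] := boolP (x \in codom z).
    by rewrite /multiple_zero mupz alpha_gt1.
  rewrite /multiple_zero mupNz ?ltnNge ?leq_b1 // => i.
  by apply: contraNneq xNz => ->; apply: codom_f.
split=> //; last first.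
  exists z; split=> // x; rewrite multf; split=> [/codomP//|[i ->]].
  exact: codom_f.
split.
- by rewrite scaler_eq0 !mulf_eq0 !negb_or c0 nodes0.
- exists rs; split=> // x; rewrite /simple_zero.
  have [/codomP[i ->]|xNz] := boolP (x \in codom z).
    by rewrite mupz (negPf (zNrs i)) gtn_eqF.
  rewrite mupNz ?eqb1 // => i.
  by apply: contraNneq xNz => ->; apply: codom_f.
exists (codom z); split=> [||x]; rewrite ?multf ?size_codom ?card_ord //.
by rewrite codomE map_inj_uniq ?enum_uniq.
Qed.

(** Double counting; it turns sums of multiplicities into counts in a list of roots. *)
Lemma sum_count_mem (T : eqType) (s rs : seq T) : uniq s ->
  (\sum_(a <- s) count_mem a rs = count [in s] rs)%N.
Proof.
move=> uniq_s; elim: rs => [|r rs IHrs] /=; first by rewrite big1.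
rewrite big_split /= IHrs; congr (_ + _)%N.
rewrite -(count_uniq_mem r uniq_s) -sum1_count [RHS]big_mkcond /=.
by apply: eq_bigr => a _; rewrite eq_sym; case: eqP.
Qed.

(** * Algebraically closed fields: degree counts and the cases decided by [k] and [m] alone *)

Section Closed.
Variable K : closedFieldType.

Lemma mup_count_roots (p : {poly K}) : exists2 rs : seq K,
  (size p).-1 = size rs & p != 0 -> forall x, mup x p = count_mem x rs.
Proof.
have [rs Dp] := closed_field_poly_normal p.
have [p0|pN0] := eqVneq p 0; first by exists [::]; rewrite // p0 size_poly0.
exists rs => [|_ x].
  by rewrite Dp size_scale ?lead_coef_eq0 // size_prod_XsubC.
rewrite Dp -mul_polyC mupMr ?mu_prod_XsubC //.
by rewrite rootC lead_coef_eq0.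
Qed.

Lemma sum_mup_le (p : {poly K}) (s : seq K) : p != 0 -> uniq s ->
  (\sum_(a <- s) mup a p <= (size p).-1)%N.
Proof.
move=> p0 uniq_s; have [rs -> /(_ p0) mupE] := mup_count_roots p.
by under eq_bigr do rewrite mupE; rewrite sum_count_mem // count_size.
Qed.

Lemma sum_mup_eq (p : {poly K}) (s : seq K) : p != 0 -> uniq s ->
  (forall x, root p x -> x \in s) -> (\sum_(a <- s) mup a p = (size p).-1)%N.
Proof.
move=> p0 uniq_s all_s; have [rs -> /(_ p0) mupE] := mup_count_roots p.
under eq_bigr do rewrite mupE; rewrite sum_count_mem //.
apply/eqP; rewrite -all_count; apply/allP => x x_rs; apply: all_s.
by rewrite -dvdp_XsubCl XsubC_dvd // mupE -has_count has_pred1.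
Qed.

Hypothesis K0 : [pchar K] =i pred0.

Lemma full_integral_bound k m (f : {poly K}) :
  poly_type k m f -> has_full_integral f -> (m <= k + 1)%N.
Proof.
case=> f0 [s1 [uniq_s1 <- s1P]] [s2 [uniq_s2 <- s2P]] [P [P'f fullP]].
have P0 : P != 0 by apply: contraNneq f0 => P0; rewrite -P'f P0 deriv0.
have uniq_s : uniq (s1 ++ s2).
  rewrite cat_uniq uniq_s1 uniq_s2 andbT; apply/hasPn => x.
  by rewrite s1P s2P /simple_zero /multiple_zero => /gtn_eqF->.
have : (\sum_(a <- s1 ++ s2) mup a f = (size f).-1)%N.
  apply: sum_mup_eq => // x; rewrite -dvdp_XsubCl XsubC_dvd // mem_cat s1P s2P.
  by rewrite /simple_zero /multiple_zero leq_eqVlt eq_sym.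
have : (\sum_(a <- s2) mup a P <= (size P).-1)%N by apply: sum_mup_le.
have -> : (\sum_(a <- s2) mup a P = \sum_(a <- s2) mup a f + size s2)%N.
  rewrite -sum1_size -big_split /= !big_seq; apply: eq_bigr => a.
  rewrite s2P /multiple_zero mup_geq // => /fullP; rewrite dvdp_XsubCl => aP.
  by rewrite (pchar0_mup_deriv K0 P0 aP) P'f addn1.
have -> : (\sum_(a <- s1 ++ s2) mup a f = size s1 + \sum_(a <- s2) mup a f)%N.
  rewrite big_cat -sum1_size; congr (_ + _)%N; rewrite !big_seq.
  by apply: eq_bigr => a; rewrite s1P => /eqP.
have : (size P <= (size f).+1)%N.
  have [c ->] : exists c, P = antideriv f + c%:P.
    have [|c Dc] := @pchar0_deriv_eq0 _ K0 (P - antideriv f).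
      by rewrite derivB P'f antiderivK // subrr.
    by exists c; rewrite -Dc addrC subrK.
  apply: leq_trans (size_polyD _ _) _; rewrite geq_max size_poly /=.
  exact: leq_trans (size_polyC_leq1 _) _.
(* Positivity keeps [(size f).-1] from truncating. With [S] the sum over the multiple zeros,
   [S + m <= deg P <= deg f + 1 = k + S + 1]. *)
have : (0 < size f)%N by rewrite size_poly_gt0.
move: (size f) (size P) (size s1) (size s2) (\sum_(a <- s2) mup a f)%N.
move=> a b c d e; lia.
Qed.

Lemma full_integral_le1 k m (f : {poly K}) :
  poly_type k m f -> (m <= 1)%N -> has_full_integral f.
Proof.
case=> f0 _ [s [_ <- sP]] le_s1; pose a := head 0 s.
exists (antideriv f - (antideriv f).[a]%:P); split=> [|b].
  by rewrite derivB derivC subr0 antiderivK.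
rewrite -mup_geq // => fb; have {fb}: b \in s by rewrite sP.
rewrite dvdp_XsubCl rootE !hornerE subr_eq0 /a.
by case: s le_s1 {sP a} => [|c [|? ?]] //= _; rewrite inE => /eqP->.
Qed.

(** * Existence with prescribed multiplicities *)

Section Prescribed.
Variables (k m : nat) (alpha : 'I_m -> nat).
Hypothesis alpha_gt1 : forall i, (1 < alpha i)%N.

(** The exponent [c] at the nodes from [m] on is 0 for the first construction, where they are no
    zeros of [f], and 1 for the second, where they are its simple zeros. *)
Let ext c (i : nat) : nat := oapp alpha c (insub i).

Let extE c (i : 'I_m) : ext c i = alpha i.
Proof. by rewrite /ext valK. Qed.

Let ext_out c i : (m <= i)%N -> ext c i = c.
Proof. by move=> le_mi; rewrite /ext insubF // ltnNge le_mi. Qed.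

Let inj_z : injective (fun i : 'I_m => i%:R : K).
Proof. by move=> i j /(pchar0_natr_inj K0)/val_inj. Qed.

Lemma exists_full_integral : (m <= k + 1)%N -> exists f : {poly K},
  [/\ poly_type k m f, multiple_zeros_mult alpha f & has_full_integral f].
Proof.
rewrite addn1 => le_mk.
pose e := ext 0; pose f := node_prod K e k.+1 * critical K e k.+1.
have [sep_c size_c] := critical_separable realalg e (ltn0Sn k).
(* Separability and size are invariant under field extension: they descend from [realalg] to [rat]
   and then pass to [K]. *)
have sepK : separable_poly (critical K e k.+1).
  rewrite -(map_critical (pchar0_ratr K0)) separable_map.
  by rewrite -(separable_map (@ratr realalg)) map_critical.
have sizeK : size (critical K e k.+1) = k.+1.
  rewrite -(map_critical (pchar0_ratr K0)) size_map_poly.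
  by rewrite -(size_map_poly (@ratr realalg)) map_critical.
have [rs Dc] := closed_field_poly_normal (critical K e k.+1).
set c := lead_coef _ in Dc.
have c0 : c != 0 by rewrite lead_coef_eq0 -size_poly_gt0 sizeK.
have size_rs : size rs = k.
  by apply: succn_inj; rewrite -sizeK Dc size_scale // size_prod_XsubC.
have uniq_rs : uniq rs.
  by rewrite -separable_prod_XsubC -(eqp_separable (eqp_scale _ c0)) -Dc.
have Df : f = c *: (\prod_(i < m) ('X - (i%:R)%:P) ^+ alpha i
                     * \prod_(r <- rs) ('X - r%:P)).
  rewrite /f {1}Dc -scalerAr; congr (_ *: (_ * _)).
  rewrite /node_prod -(subnKC le_mk) big_split_ord /= [X in _ * X]big1 ?mulr1.
    by apply: eq_bigr => i _; rewrite /e extE.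
  by move=> i _; rewrite /e ext_out ?leq_addr // expr0.
have zNrs (i : 'I_m) : i%:R \notin rs.
  have := critical_node_neq0 e K0 (leq_trans (ltn_ord i) le_mk).
  by rewrite Dc rootZ // root_prod_XsubC.
have [typef multf zerosf] := prod_XsubC_type c0 alpha_gt1 inj_z uniq_rs zNrs.
rewrite size_rs -Df in typef multf zerosf.
exists f; split=> //; exists (node_prod K (fun i => (e i).+1) k.+1).
split=> [|a]; first exact: deriv_node_prod.
rewrite -mup_geq; last by case: typef.
rewrite -[(1 < _)%N]/(multiple_zero f a) zerosf => /codomP[i ->].
by rewrite dvdp_XsubCl root_node_prodT // (leq_trans (ltn_ord i)).
Qed.

Lemma exists_no_full_integral : (1 < m)%N -> exists f : {poly K},
  [/\ poly_type k m f, multiple_zeros_mult alpha f & ~ has_full_integral f].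
Proof.
move=> m_gt1; pose e := ext 1; pose f := node_prod K e (m + k).
pose rs : seq K := codom (fun i : 'I_k => (m + i)%:R).
have uniq_rs : uniq rs.
  rewrite /rs codomE map_inj_uniq ?enum_uniq // => i j.
  by move/(pchar0_natr_inj K0)/addnI/val_inj.
have size_rs : size rs = k by rewrite size_codom card_ord.
have Df : f = 1 *: (\prod_(i < m) ('X - (i%:R)%:P) ^+ alpha i
                     * \prod_(r <- rs) ('X - r%:P)).
  rewrite scale1r /f /node_prod big_split_ord /rs codomE big_map big_enum /=.
  congr (_ * _); apply: eq_bigr => i _; first by rewrite /e extE.
  by rewrite /e ext_out ?leq_addr.
have zNrs (i : 'I_m) : i%:R \notin rs.
  apply/codomP => -[j /(pchar0_natr_inj K0) Di].
  by have := ltn_ord i; rewrite Di ltnNge leq_addr.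
have [typef multf zerosf] :=
  prod_XsubC_type (oner_neq0 K) alpha_gt1 inj_z uniq_rs zNrs.
rewrite size_rs -Df in typef multf zerosf.
exists f; split=> // -[P [P'f fullP]].
have rootP i : (i < m)%N -> P.[i%:R] = 0.
  move=> lt_im; apply/eqP; rewrite -[_ == 0]dvdp_XsubCl; apply: fullP.
  rewrite -mup_geq; last by case: typef.
  by have := zerosf i%:R; rewrite (codom_f _ (Ordinal lt_im)).
pose G := antideriv (node_prod rat e (m + k)).
have G'E : G^`() = node_prod rat e (m + k) by apply/antiderivK/pchar_num.
(* Over [K], [P] and the image of [G] differ by a constant, and [P] vanishes at the multiple zeros 0
   and 1. Injectivity of the embedding brings the equality back to [rat], hence to [realalg] for
   Rolle. *)
have G01 : G.[0] = G.[1].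
  apply: (fmorph_inj (pchar0_ratr K0)).
  have [|c Dc] := @pchar0_deriv_eq0 _ K0 (P - map_poly (pchar0_ratr K0) G).
    by rewrite derivB deriv_map G'E map_node_prod P'f subrr.
  have GE i : (i < m)%N -> pchar0_ratr K0 G.[i%:R] = - c.
    move=> lt_im; rewrite -horner_map rmorph_nat.
    have /(congr1 (fun p => p.[i%:R])) := Dc.
    by rewrite !hornerE rootP // sub0r => <-; rewrite opprK.
  exact: etrans (GE 0 (ltnW m_gt1)) (esym (GE 1 m_gt1)).
have [|c] := @poly_rolle realalg 0 1 (map_poly ratr G) ltr01.
  rewrite -(rmorph0 (@ratr realalg)) -(rmorph1 (@ratr realalg)).
  by rewrite !horner_map G01.
rewrite inE /= => /andP[c_gt0 c_lt1] /eqP.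
rewrite deriv_map G'E map_node_prod => /root_node_prod[i _ /andP[_]].
by rewrite (negPf (node_interval_neq (i := 0) _ c_gt0 c_lt1)).
Qed.

End Prescribed.
End Closed.

Theorem theorem2p14 (K : closedFieldType) (charK0 : [pchar K] =i pred0) :
  [/\ forall (k m : nat) (f : {poly K}), poly_type k m f ->
        (m <= 1)%N -> has_full_integral f,
      forall (k m : nat) (f : {poly K}), poly_type k m f ->
        (m > k + 1)%N -> ~ has_full_integral f
    & forall k m : nat, ~ (m <= 1)%N -> ~ (m > k + 1)%N ->
        forall alpha : 'I_m -> nat, (forall i, (alpha i > 1)%N) ->
        (exists f1 : {poly K},
           [/\ poly_type k m f1, multiple_zeros_mult alpha f1
             & has_full_integral f1]) /\
        (exists f2 : {poly K},
           [/\ poly_type k m f2, multiple_zeros_mult alpha f2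
             & ~ has_full_integral f2])].
Proof.
split=> [k m f|k m f typef|k m m_gt1 le_mk alpha alpha_gt1].
- exact: full_integral_le1.
- by rewrite ltnNge => /negP le_mk /(full_integral_bound charK0 typef).
move/negP: m_gt1; rewrite -ltnNge => m_gt1.
move/negP: le_mk; rewrite -leqNgt => le_mk.
by split; [apply: exists_full_integral | apply: exists_no_full_integral].
Qed.
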